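(* (i) The Fraïssé limit of the class of all finite $\omega$-partite tournaments has ample generics. (ii) For every $n\in\{2,3,\ldots\}$, the Fraïssé limit of the class of all finite $n$-partite tournaments does not have $1$-generic automorphisms. In fact, its automorphism group does not even have a dense conjugacy class.
   Context: A directed graph is a structure with one binary relation which is irreflexive and antisymmetric (no loops, no bi-directional edges). Given $n\in\{2,3,\ldots,\omega\}$, a directed graph $\mathbf A$ is an $n$-partite tournament if its vertex set can be partitioned into (possibly empty) pairwise disjoint sets $A_1\cup A_2\cup\cdots\cup A_n=A$ (countably many sets $A_1,A_2,\ldots$ if $n=\omega$), called parts, such that every pair of vertices in different parts is connected by a directed edge (in exactly one direction) and there are no edges between vertices in the same part. The parts are not named by the language. A structure is homogeneous if every isomorphism between its finite substructures extends to an automorphism. The Fraïssé limit of a class $\mathcal C$ of finite structures is the (unique up to isomorphism) countable homogeneous structure such that the finite structures embedding into it are exactly the members of $\mathcal C$. For a countable structure $\mathbf M$, the group $G=\mathrm{Aut}(\mathbf M)$ carries the topology of pointwise convergence ($\mathbf M$ being discrete). For an integer $m\ge 1$, $\mathbf M$ has $m$-generic automorphisms if $G$ has a comeagre orbit on $G^m$ in its action by diagonal conjugation $g\cdot(h_1,\ldots,h_m)=(gh_1g^{-1},\ldots,gh_mg^{-1})$. $\mathbf M$ has ample generics if it has $m$-generic automorphisms for every $m\geq 1$. *)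

(* Defs.v *)
From HB Require Import structures.
From mathcomp Require Import all_boot.
From mathcomp Require Import boolp classical_sets functions cardinality topology.

Set Implicit Arguments.
Unset Strict Implicit.
Unset Printing Implicit Defensive.

Local Open Scope classical_set_scope.

(* A structure with one binary relation is a type together with e : rel T;    *)
(* it is countable if T : countType and finite if T : finType.                *)

Definition digraph (T : Type) (e : rel T) : Prop :=
  irreflexive e /\ antisymmetric e.

Definition parts_of (I T : Type) (e : rel T) (A : I -> set T) : Prop :=
  [/\ \bigcup_i A i = [set: T],
      (forall i j, i <> j -> A i `&` A j = set0),
      (forall i j x y, i <> j -> A i x -> A j y -> e x y || e y x) &
      (forall i x y, A i x -> A i y -> ~~ e x y)].

(* The index type I of the parts is 'I_n for n-partite tournaments with n     *)
(* finite, and nat for omega-partite tournaments.                             *)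
Definition partite_tournament (I T : Type) (e : rel T) : Prop :=
  digraph e /\ exists A : I -> set T, parts_of e A.

Definition embedding (S T : Type) (d : rel S) (e : rel T) (f : S -> T) : Prop :=
  injective f /\ forall x y, e (f x) (f y) = d x y.

Definition finite_class := forall T : finType, rel T -> Prop.

Definition finite_partite_tournament (I : Type) : finite_class :=
  fun T e => partite_tournament I e.

Definition automorphism (T : Type) (e : rel T) (g : T -> T) : Prop :=
  bijective g /\ forall x y, e (g x) (g y) = e x y.

(* Only the values of p on the finite substructure A are relevant.            *)
Definition homogeneous (T : Type) (e : rel T) : Prop :=
  forall (A B : set T) (p : T -> T), finite_set A -> finite_set B ->
    set_bij A B p -> (forall x y, A x -> A y -> e (p x) (p y) = e x y) ->
  exists2 g, automorphism e g & forall x, A x -> g x = p x.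

Definition fraisse_limit (C : finite_class) (V : countType) (E : rel V) : Prop :=
  homogeneous E /\
  forall (T : finType) (e : rel T),
    C T e <-> exists f : T -> V, embedding e E f.

(* Aut(M), a subspace of the product of V copies of the discrete space V.     *)
Definition Aut (V : countType) (E : rel V) : Type :=
  set_type [set g : {ptws V -> discrete_topology V} | automorphism E g].

HB.instance Definition _ (V : countType) (E : rel V) :=
  Topological.copy (Aut E)
    (set_type [set g : {ptws V -> discrete_topology V} | automorphism E g]).

Section AutGroup.
Variables (V : countType) (E : rel V).

Definition aut_fun (g : Aut E) : V -> V := \val g.

Definition mkAut (g : V -> V) (h : automorphism E g) : Aut E :=
  exist (fun g => g \in [set g | automorphism E g]) g (mem_set h).

Lemma aut_funP (g : Aut E) : automorphism E (aut_fun g).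
Proof. exact: set_mem (valP g). Qed.

Lemma aut_ext (g h : Aut E) : aut_fun g =1 aut_fun h -> g = h.
Proof. by move=> gh; apply: val_inj; apply/funext. Qed.

Lemma aut_one_proof : automorphism E id.
Proof. by split=> //; exists id. Qed.

Lemma aut_mul_proof (g h : Aut E) : automorphism E (aut_fun g \o aut_fun h).
Proof.
have [[bg eg] [bh eh]] := (aut_funP g, aut_funP h).
by split=> [|x y /=]; [exact: bij_comp | rewrite eg eh].
Qed.

Lemma aut_inv_ex (g : Aut E) :
  exists2 h, automorphism E h & cancel (aut_fun g) h /\ cancel h (aut_fun g).
Proof.
have [[h gK hK] eg] := aut_funP g; exists h => //.
by split=> [|x y]; [exists (aut_fun g) | rewrite -eg !hK].
Qed.

Definition aut_one : Aut E := mkAut aut_one_proof.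
Definition aut_mul (g h : Aut E) : Aut E := mkAut (aut_mul_proof g h).
Definition aut_inv (g : Aut E) : Aut E := mkAut (s2valP (cid2 (aut_inv_ex g))).

Lemma aut_mulA : associative aut_mul.
Proof. by move=> x y z; apply: aut_ext. Qed.
Lemma aut_mul1g : left_id aut_one aut_mul.
Proof. by move=> x; apply: aut_ext. Qed.
Lemma aut_mulg1 : right_id aut_one aut_mul.
Proof. by move=> x; apply: aut_ext. Qed.
Lemma aut_mulVg : left_inverse aut_one aut_inv aut_mul.
Proof. by move=> g; apply: aut_ext; case: (s2valP' (cid2 (aut_inv_ex g))). Qed.
Lemma aut_mulgV : right_inverse aut_one aut_inv aut_mul.
Proof. by move=> g; apply: aut_ext; case: (s2valP' (cid2 (aut_inv_ex g))). Qed.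

HB.instance Definition _ := isGroup.Build (Aut E)
  aut_mulA aut_mul1g aut_mulg1 aut_mulVg aut_mulgV.

End AutGroup.

Definition nowhere_dense (X : topologicalType) (A : set X) : Prop :=
  interior (closure A) = set0.

Definition meagre (X : topologicalType) (A : set X) : Prop :=
  exists2 F : nat -> set X, (forall n, nowhere_dense (F n)) &
    A `<=` \bigcup_n F n.

Definition comeagre (X : topologicalType) (A : set X) : Prop := meagre (~` A).

(* mathcomp's x ^ y is y^-1 * x * y, hence the explicit products below.       *)
Definition diag_conj_orbit (G : groupType) (m : nat) (h : 'I_m -> G) :
    set ('I_m -> G) :=
  [set k | exists g : G, k = (fun i => g * h i * g^-1)%g].

Definition conj_class (G : groupType) (h : G) : set G :=
  [set k | exists g : G, k = (g * h * g^-1)%g].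

Definition has_generic_automorphisms (m : nat) (V : countType) (E : rel V) :
    Prop :=
  exists h : 'I_m -> Aut E,
    comeagre (diag_conj_orbit h : set {ptws 'I_m -> Aut E}).

Definition ample_generics (V : countType) (E : rel V) : Prop :=
  forall m, (1 <= m)%N -> has_generic_automorphisms m E.

Definition has_dense_conj_class (V : countType) (E : rel V) : Prop :=
  exists h : Aut E, dense (conj_class h : set (Aut E)).

(* Main.v *)
Require Import Defs.
From mathcomp Require Import all_boot.
From mathcomp Require Import boolp classical_sets functions cardinality.
From mathcomp Require Import topology.

(* Call a tuple h of automorphisms of the omega-partite limit generic if every
   vertex lies in a finite h-stable set, and every finite extension, with
   automorphisms, of a finite h-stable set is realized in h over that set.
   Two generic tuples are conjugate by back-and-forth.  Generic tuples form a
   comeagre set: the first condition is dense because finite multipartite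
   tournaments have the extension property for partial automorphisms (EPPA),
   the second because two extensions W and T of S amalgamate by orienting all
   new edges from W to T, which is invariant under any automorphisms of W and
   T agreeing on S.  For n finite, the automorphisms fixing every part form a
   clopen normal subgroup, proper by homogeneity; a conjugacy class lies in it
   or misses it, so none is dense, nor comeagre by Baire category. *)

Set Implicit Arguments.
Unset Strict Implicit.
Unset Printing Implicit Defensive.

Local Open Scope classical_set_scope.

(** * The topology of tuples of automorphisms *)

(** Dependent choice with an invariant [P] and a task [R n] at step [n]; it drives both the Baire
    argument and the back-and-forth. *)
Lemma choice_seq (T : Type) (P : T -> Prop) (R : nat -> T -> T -> Prop)
    (x0 : T) :
  P x0 -> (forall n x, P x -> exists2 y, P y & R n x y) ->
  exists2 u : nat -> T, u 0 = x0 & forall n, P (u n) /\ R n (u n) (u n.+1).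
Proof.
move=> Px0 PR.
have [F HF] : {F : nat * T -> T &
    forall p, P p.2 -> P (F p) /\ R p.1 p.2 (F p)}.
  apply: (@choice _ _ (fun p y => P p.2 -> P y /\ R p.1 p.2 y)) => -[n x].
  have [Px|nPx] := pselect (P x); last by exists x.
  by have [y Py Rxy] := PR n x Px; exists y.
pose u n := iteri n (fun n x => F (n, x)) x0; exists u => //.
have Pu n : P (u n) by elim: n => //= n IHn; have [] := HF (n, u n) IHn.
by move=> n; split=> //; have [] := HF (n, u n) (Pu n).
Qed.

#[local] Coercion aut_fun : Aut >-> Funclass.

Section Pointwise.
Variables (V : countType) (E : rel V).

Lemma open_aut_eval (x y : V) : open [set g : Aut E | g x = y].
Proof.
exists [set g : {ptws V -> discrete_topology V} | g x = y] => //.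
apply: (@open_comp _ _ _ ([set y] : set (discrete_topology V))) => [g _|].
  exact: (@proj_continuous V (fun=> discrete_topology V) x).
exact: discrete_open.
Qed.

Lemma cvg_aut (F : set_system (Aut E)) (h : Aut E) : Filter F ->
  (forall x, F [set g | g x = h x]) -> F --> h.
Proof.
move=> FF Fh A [_ [[B Bo <-] Bh BA]].
apply: (filterS BA); change ((\val @ F) B).
have : (\val @ F : set_system {ptws V -> discrete_topology V}) -->
    (aut_fun h : {ptws V -> discrete_topology V}).
  apply/cvg_sup => x C [_ [[D Do <-] Dh DC]].
  apply: (filterS DC); change (F [set g | D (g x)]).
  by apply: filterS (Fh x) => g /= ->.
by apply; apply: open_nbhs_nbhs.
Qed.

Variable m : nat.
Implicit Types (h g : 'I_m -> Aut E) (S : seq V).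

Definition agree h S : set {ptws 'I_m -> Aut E} :=
  [set g | forall i x, x \in S -> g i x = h i x].

Lemma open_agree h S : open (agree h S).
Proof.
rewrite openE => g gh; rewrite /interior.
have nbhsg i x : x \in S ->
    \forall k \near (g : {ptws 'I_m -> Aut E}), aut_fun (k i) x = h i x.
  move=> xS.
  have pC := @proj_continuous _ (fun=> Aut E : topologicalType) i g.
  suff: nbhs (g i) [set k : Aut E | aut_fun k x = h i x] by move/pC.
  by apply: open_nbhs_nbhs; split; [exact: open_aut_eval | exact: gh].
elim: S nbhsg {gh} => [|x S IHS] nbhsg; first exact: filterE.
have /IHS nS : forall i y, y \in S ->
    \forall k \near (g : {ptws 'I_m -> Aut E}),
      aut_fun (k i) y = aut_fun (h i) y.
  by move=> i y yS; apply: nbhsg; rewrite inE yS orbT.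
have Fg : Filter (nbhs (g : {ptws 'I_m -> Aut E})) by apply: nbhs_filter.
have nx := filter_forall Fg (fun i => nbhsg i x (mem_head x S)).
apply: filterS2 nx nS => k kx kS i y; rewrite inE => /orP[/eqP->|yS].
  exact: kx.
exact: kS.
Qed.

(** The sets [agree h S] generate a filter, which converges to [h]: convergence in the product is
    tested on each coordinate, and in [Aut E] on the value at each vertex, where a singleton [S]
    suffices. *)
Lemma nbhs_agree h (A : set {ptws 'I_m -> Aut E}) :
  nbhs (h : {ptws 'I_m -> Aut E}) A -> exists S, agree h S `<=` A.
Proof.
pose F : set_system {ptws 'I_m -> Aut E} := filter_from setT (agree h).
have FF : Filter F.
  apply: filter_from_filter; first by exists [::].
  move=> S T _ _; exists (S ++ T) => // g gh.
  by split=> i x xS; apply: gh; rewrite mem_cat xS ?orbT.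
suff Fh : F --> (h : {ptws 'I_m -> Aut E}) by move=> /Fh [S _ SA]; exists S.
apply/cvg_sup => i C [_ [[D Do <-] Dh DC]]; apply: (filterS DC).
pose ev (k : {ptws 'I_m -> Aut E}) := k i.
have FiF : Filter (ev @ F) by exact: fmap_filter.
have: (ev @ F) --> h i.
  apply: cvg_aut => x; exists [:: x] => // g /(_ i x); rewrite inE eqxx.
  by apply.
by apply; apply: open_nbhs_nbhs.
Qed.

End Pointwise.

(** * Baire category for tuples of automorphisms *)

Section AutBaire.
Variables (V : countType) (E : rel V).
Implicit Types g h : Aut E.

Lemma aut_rel g x y : E (g x) (g y) = E x y.
Proof. by have [_] := aut_funP g. Qed.

Lemma aut_inj g : injective g.
Proof. by have [/bij_inj] := aut_funP g. Qed.

Lemma aut_invK g : cancel (aut_inv g) g.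
Proof. by rewrite /aut_inv /= => x; case: (cid2 _) => h /= ? []. Qed.

Lemma aut_funK g : cancel g (aut_inv g).
Proof. by move=> x; apply: (@aut_inj g); rewrite aut_invK. Qed.

Lemma aut_surj (g : V -> V) : (forall x y, E (g x) (g y) = E x y) ->
  injective g -> (forall y, exists x, g x = y) -> automorphism E g.
Proof.
move=> gE ginj gsurj; split=> //; have [h hK] := choice gsurj.
by exists h => // x; apply: ginj; rewrite hK.
Qed.

(** A pointwise limit of automorphisms may fail to be surjective, so the images of the [S n] have to
    exhaust [V] as well as the [S n] themselves. *)
Lemma aut_limit (q : nat -> Aut E) (S : nat -> seq V) :
  (forall n, {subset S n <= S n.+1}) ->
  (forall n x, x \in S n -> q n.+1 x = q n x) ->
  (forall x, exists n, x \in S n) ->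
  (forall y, exists n, exists2 x, x \in S n & q n x = y) ->
  exists g, forall n x, x \in S n -> g x = q n x.
Proof.
move=> SS qS Scov Srange.
have mono n k x : n <= k -> x \in S n -> x \in S k /\ q k x = q n x.
  move=> /subnK <- xS; elim: (k - n) => [|d [xSd qd]] //.
  by rewrite addSn; split; [exact: SS | rewrite qS].
have [N NS] := choice Scov; pose g x := q (N x) x.
have gq n x : x \in S n -> g x = q n x.
  move=> xS; have [_ <-] := mono _ _ _ (leq_maxl n (N x)) xS.
  by have [_ ->] := mono _ _ _ (leq_maxr n (N x)) (NS x).
have gq2 x y : exists n, g x = q n x /\ g y = q n y.
  exists (maxn (N x) (N y)); rewrite -!gq //.
    by have [] := mono _ _ _ (leq_maxr (N x) (N y)) (NS y).
  by have [] := mono _ _ _ (leq_maxl (N x) (N y)) (NS x).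
have gP : automorphism E g.
  apply: aut_surj => [x y|x y|y].
  - by have [n [-> ->]] := gq2 x y; rewrite aut_rel.
  - by have [n [-> ->]] := gq2 x y => /aut_inj.
  - by have [n [x xS <-]] := Srange y; exists x; rewrite (gq n).
by exists (mkAut gP).
Qed.

Variable m : nat.
Implicit Types (u v : 'I_m -> Aut E) (S T : seq V).
Implicit Types (A : set {ptws 'I_m -> Aut E}).

Lemma agree_refl u S : agree u S u. Proof. by []. Qed.
Arguments agree_refl : clear implicits.

Lemma nowhere_denseP A : nowhere_dense A <->
  forall u S, exists v T, agree v T `<=` agree u S `\` A.
Proof.
split=> [A0 u S|Adense]; last first.
  rewrite /nowhere_dense -subset0 => u /nbhs_agree[S SA].
  have [v [T TSA]] := Adense u S.
  have /SA : agree u S v by have [] := TSA _ (agree_refl v T).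
  have nT : nbhs (v : {ptws 'I_m -> Aut E}) (agree v T).
    by apply: open_nbhs_nbhs; split; [exact: open_agree | exact: agree_refl].
  by move=> /(_ _ nT)[w [Aw /TSA[]]].
have : ~ (agree u S `<=` closure A).
  move=> SA; have : interior (closure A) u.
    apply: (filterS SA); apply: open_nbhs_nbhs.
    by split; [exact: open_agree | exact: agree_refl].
  by rewrite A0.
move=> /existsNP[v /not_implyP[vS /existsNP[B /not_implyP[vB AB]]]].
have : nbhs (v : {ptws 'I_m -> Aut E}) (agree u S `&` B).
  by apply: filterI => //; apply: open_nbhs_nbhs; split; [exact: open_agree|].
move=> /nbhs_agree[T TSB]; exists v, T => w /TSB[wS wB]; split=> // Aw.
by apply: AB; exists w.
Qed.

Lemma meagre_countable (I : countType) (F : I -> set {ptws 'I_m -> Aut E}) A :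
  (forall i, nowhere_dense (F i)) -> A `<=` \bigcup_i F i -> meagre A.
Proof.
move=> F0 AF; exists (fun n => if unpickle n is Some i then F i else set0).
  move=> n; case: unpickle => [i|]; first exact: F0.
  by rewrite /nowhere_dense closure0 interior0.
by move=> u /AF[i _ Fi]; exists (pickle i) => //; rewrite pickleK.
Qed.

(** The Baire category theorem: shrinking basic open sets [agree (w n).1 (w n).2] avoid the sets
    [F n] one after the other and have a common point. *)
Lemma agree_not_meagre u S : ~ meagre (agree u S).
Proof.
move=> [F F0 uF].
pose R n (p p' : ('I_m -> Aut E) * seq V) := [/\ {subset p.2 <= p'.2},
  agree p.1 p.2 p'.1, agree p'.1 p'.2 `<=` ~` F n &
  forall x, unpickle n = Some x -> x \in p'.2 /\
    forall i, exists2 z, z \in p'.2 & p'.1 i z = x].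
have [||w w0 wR] := @choice_seq _ (fun=> True) R (u, S) => //.
  move=> n [v T] _; have /nowhere_denseP/(_ v T)[v' [T' vT']] := F0 n.
  (* Adding the vertex coded by [n] and its preimages puts it in the domain and the range of every
     coordinate, as [aut_limit] requires. *)
  pose X : seq V := if unpickle n is Some x then
    x :: [seq aut_inv (v' i) x | i <- enum 'I_m] else [::].
  exists (v', T ++ T' ++ X) => //; split=> /=.
  - by move=> x; rewrite mem_cat => ->.
  - by have [] := vT' _ (agree_refl v' T').
  - move=> w wv; have wT' : agree v' T' w.
      by move=> i x xT'; apply: wv; rewrite !mem_cat xT' orbT.
    by have [] := vT' _ wT'.
  - rewrite /X => x ->; split; first by rewrite !mem_cat mem_head !orbT.
    move=> i; exists (aut_inv (v' i) x); last exact: aut_invK.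
    by rewrite !mem_cat inE (map_f (fun i => aut_inv (v' i) x)) ?mem_enum ?orbT.
have Rw n := proj2 (wR n).
have limw i : exists g, forall n x, x \in (w n).2 -> g x = (w n).1 i x.
  apply: aut_limit => [n|n x xS|x|x].
  - by have [] := Rw n.
  - by have [_ + _ _] := Rw n; apply.
  - have [_ _ _ /(_ x)] := Rw (pickle x); rewrite pickleK => /(_ erefl)[xw _].
    by exists (pickle x).+1.
  - have [_ _ _ /(_ x)] := Rw (pickle x).
    rewrite pickleK => /(_ erefl)[_ /(_ i)].
    by exists (pickle x).+1.
have [g gw] := choice limw.
have gagree n : agree (w n).1 (w n).2 g by move=> i x; apply: gw.
have [n _ Fg] : (\bigcup_n F n) g by apply: uF; have := gagree 0; rewrite w0.
by have [_ _ /(_ g (gagree _))] := Rw n.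
Qed.

Lemma comeagre_nonempty A : comeagre A -> exists u, A u.
Proof.
move=> [F F0 AF]; apply: contrapT => nA.
apply: (@agree_not_meagre (fun=> aut_one E) [::]); exists F => // u _.
by apply: AF => Au; apply: nA; exists u.
Qed.

End AutBaire.

(** * EPPA for multipartite tournaments *)

Definition nonadj (T : Type) (e : rel T) : rel T :=
  fun x y => ~~ (e x y || e y x).

(** Index-free form: the parts are the classes of [nonadj], with no names and no bound on their
    number. *)
Definition multipartite (T : Type) (e : rel T) : Prop :=
  [/\ irreflexive e, forall x y, e x y -> ~~ e y x & transitive (nonadj e)].

Lemma nonadjC (T : Type) (e : rel T) x y : nonadj e x y = nonadj e y x.
Proof. by rewrite /nonadj orbC. Qed.

Lemma addb_transpose (a b c d x y : bool) :
  b (+) d (+) x = a (+) c (+) y -> a (+) b (+) (c (+) d) = x (+) y.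
Proof. by case: a b c d x y => [] [] [] [] [] []. Qed.

(** The complements of [D] and of its image have the same size, so listing [D] and then its
    complement, and the images and then their complement, matches the two lists by position. *)
Lemma inj_extension (T : finType) (D : {pred T}) (f : T -> T) :
  {in D &, injective f} -> exists2 g, injective g & {in D, g =1 f}.
Proof.
move=> finj; pose im : {pred T} := [in [seq f x | x in D]].
pose s := enum D ++ enum [predC D].
pose t := [seq f x | x in D] ++ enum [predC im].
have sT x : x \in s by rewrite mem_cat !mem_enum orbN.
have szE : size (enum [predC D]) = size (enum [predC im]).
  rewrite -!cardE; apply/eqP; rewrite -(eqn_add2l #|D|) cardC.
  by rewrite -(card_in_image finj) cardC.
have szt : size t = size s by rewrite !size_cat size_map szE.
have tU : uniq t.
  rewrite cat_uniq map_inj_in_uniq ?enum_uniq ?andbT /=; last first.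
    by move=> x y; rewrite !mem_enum; apply: finj.
  by apply/hasPn => y; rewrite mem_enum.
exists (fun x => nth x t (index x s)).
  move=> x y; rewrite (set_nth_default y) ?szt ?index_mem //.
  move/eqP; rewrite nth_uniq ?szt ?index_mem // => /eqP.
  by move/(congr1 (nth x s)); rewrite !nth_index.
move=> x xD; rewrite /s /t index_cat mem_enum xD nth_cat size_map index_mem.
by rewrite mem_enum xD (nth_map x) ?index_mem ?nth_index ?mem_enum.
Qed.

Section Multipartite.
Variables (T : Type) (e : rel T).
Hypothesis eP : multipartite e.

Lemma multipartite_irr : irreflexive e. Proof. by case: eP. Qed.

Lemma nonadjxx x : nonadj e x x.
Proof. by rewrite /nonadj multipartite_irr. Qed.

Lemma nonadj_trans : transitive (nonadj e).
Proof. by case: eP. Qed.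

End Multipartite.

Section Eppa.
Variables (A : finType) (e : rel A).
Hypothesis eP : multipartite e.

Let nonadjxx := nonadjxx eP.
Let nonadj_trans := nonadj_trans eP.

(** A canonical representative of the part of [x], since [pick] depends only on its predicate. The
    default is never reached, [nonadj] being reflexive. *)
Definition prepr x := odflt x [pick y | nonadj e x y].

Lemma preprP x y : (prepr x == prepr y) = nonadj e x y.
Proof.
have rP z : nonadj e z (prepr z).
  by rewrite /prepr; case: pickP => // /(_ z); rewrite nonadjxx.
apply/eqP/idP => [rxy|xy].
  by apply: nonadj_trans (rP x) _; rewrite rxy nonadjC.
rewrite /prepr; have /eq_pick -> : nonadj e x =1 nonadj e y.
  move=> z; apply/idP/idP; apply: nonadj_trans => //; by rewrite nonadjC.
by case: pickP => //= /(_ y); rewrite nonadjxx.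
Qed.

(** A label is a part name with a vertex. All pairs are allowed, not only [(prepr x, x)], so that
    part names and vertices can be permuted independently. *)
Let K : finType := (A * A)%type.
Let lt (k l : K) := enum_rank k < enum_rank l.

Lemma ltC (k l : K) : k != l -> lt l k = ~~ lt k l.
Proof.
move=> kl; rewrite /lt ltnNge leq_eqVlt; case: eqP => // /val_inj/enum_rank_inj.
by move/eqP; rewrite (negbTE kl).
Qed.

(* The witness: a vertex is a label k, lying in the part k.1, together with a
   valuation; an edge is oriented by the two valuations at the opposite labels
   and the order of the labels.  Valuations can be shifted freely, so the
   orientations changed by a permutation of the labels can be corrected. *)
Definition eppa_vertex : finType := (K * {ffun K -> bool})%type.

Definition eppa_rel : rel eppa_vertex := fun b c =>
  (b.1.1 != c.1.1) && (b.2 c.1 (+) c.2 b.1 (+) lt b.1 c.1).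

Lemma neq_fst (k l : K) : k.1 != l.1 -> k != l.
Proof. by apply: contra => /eqP->. Qed.

Lemma eppa_relC b c : b.1.1 != c.1.1 -> eppa_rel c b = ~~ eppa_rel b c.
Proof.
move=> bc; rewrite /eppa_rel (eq_sym c.1.1) bc /= ltC ?neq_fst //.
by rewrite addbN (addbC (c.2 _)).
Qed.

Lemma nonadj_eppa b c : nonadj eppa_rel b c = (b.1.1 == c.1.1).
Proof.
rewrite /nonadj; have [bc|bc] := eqVneq b.1.1 c.1.1.
  by rewrite /eppa_rel bc eqxx.
by rewrite (eppa_relC bc) orbN.
Qed.

Lemma multipartite_eppa : multipartite eppa_rel.
Proof.
split=> [b|b c|b c d].
- by rewrite /eppa_rel eqxx.
- by move=> bc; rewrite eppa_relC ?bc //; case/andP: bc.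
- by rewrite !nonadj_eppa => /eqP->.
Qed.

Let lab x : K := (prepr x, x).
(** For two vertices in different parts, only the valuation of the one with the smaller label can be
    nonzero at the other's label; it corrects the order of the labels to the edge of [e]. *)
Let chi x : {ffun K -> bool} := [ffun k => lt (lab x) k && ~~ e x k.2].

Lemma chiP x y : prepr x != prepr y ->
  chi x (lab y) (+) chi y (lab x) (+) lt (lab x) (lab y) = e x y.
Proof.
move=> xy; rewrite !ffunE /= (@ltC (lab x)) ?neq_fst //.
have [_ /(_ x y) asy _] := eP.
move: xy; rewrite preprP negbK; case: lt; case: (e x y) asy => //=.
  by move=> /(_ isT)/negbTE->.
by move=> _ ->.
Qed.

Definition eppa_embed x : eppa_vertex := (lab x, chi x).

Lemma eppa_embedding : embedding e eppa_rel eppa_embed.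
Proof.
split=> [x y [_ ->] //|x y]; rewrite /eppa_rel /=.
have [rxy|rxy] := eqVneq (prepr x) (prepr y); last exact: chiP.
by move/eqP: rxy; rewrite preprP /nonadj negb_or => /andP[/negbTE].
Qed.

Section Extend.
Variables (D : {pred A}) (p : A -> A).
Hypothesis pinj : {in D &, injective p}.
Hypothesis pE : {in D &, forall x y, e (p x) (p y) = e x y}.

Lemma prepr_partial : {in D &, forall x y,
  (prepr (p x) == prepr (p y)) = (prepr x == prepr y)}.
Proof. by move=> x y xD yD; rewrite !preprP /nonadj !pE. Qed.

(** By [prepr_partial], [p] induces an injection on the parts that meet [D]; [theta] is the product
    of an extension of it to all part names and an extension of [p] to all vertices. *)
Lemma eppa_perm : exists theta : K -> K, [/\ injective theta,
  forall k l, ((theta k).1 == (theta l).1) = (k.1 == l.1) &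
  {in D, forall x, theta (lab x) = lab (p x)}].
Proof.
have [sg sginj sgp] := inj_extension pinj.
pose D1 := [pred z | [exists x in D, prepr x == z]].
pose q z := if [pick x in D | prepr x == z] is Some x then prepr (p x) else z.
have qr : {in D, forall x, q (prepr x) = prepr (p x)}.
  move=> x xD; rewrite /q; case: pickP => [y /andP[yD ryx]|/(_ x)]; last first.
    by rewrite xD eqxx.
  by apply/eqP; rewrite prepr_partial.
have [|pi piinj piq] := @inj_extension _ D1 q.
  move=> _ _ /exists_inP[x xD /eqP<-] /exists_inP[y yD /eqP<-].
  by rewrite !qr // => /eqP; rewrite prepr_partial // => /eqP.
exists (fun k => (pi k.1, sg k.2)); split=> [[? ?] [? ?]||x xD].
- by move=> [/piinj-> /sginj->].
- by move=> k l; rewrite /= (inj_eq piinj).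
- rewrite /lab /= sgp // piq ?qr //.
  by apply/exists_inP; exists x.
Qed.

(** Labels are moved by [th] and valuations are shifted by [F]. Edges are preserved when
    [F k l (+) F l k] equals [S k l], which records whether [th] reverses the order of [k] and
    [l]. *)
Lemma eppa_extend : exists f : eppa_vertex -> eppa_vertex,
  automorphism eppa_rel f /\
  {in D, forall x, f (eppa_embed x) = eppa_embed (p x)}.
Proof.
have [th [thinj th1 thlab]] := eppa_perm.
pose D2 (k : K) := (k.2 \in D) && (k.1 == prepr k.2).
pose S k l := lt k l (+) lt (th k) (th l).
(* The correction F of the valuations is forced on the labels of D; elsewhere
   it only has to satisfy FS. *)
pose F k l := if D2 k then chi (p k.2) (th l) (+) chi k.2 l else
  if D2 l then chi (p l.2) (th k) (+) chi l.2 k (+) S k l else lt k l && S k l.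
have SC k l : k != l -> S l k = S k l.
  move=> kl; rewrite /S (ltC kl) (@ltC (th k)) ?(inj_eq thinj) //.
  by rewrite addbN addNb negbK.
(* If both labels come from [D], the forced values are consistent because [p] preserves [e]: compare
   [chiP] before and after [p]. If one does, the other value was defined to compensate; if none
   does, the factor [lt k l] charges [S] to one of the two orders. *)
have FS k l : k.1 != l.1 -> F k l (+) F l k = S k l.
  move=> kl; have Skl := SC _ _ (neq_fst kl); rewrite /F Skl.
  have [Dk|Dk] := boolP (D2 k); have [Dl|Dl] := boolP (D2 l).
  - case/andP: Dk => xD; case/andP: Dl => yD.
    case: k l xD yD kl {Skl} => [k x] [l y] /= xD yD kl /eqP ly /eqP kx.
    subst k l.
    rewrite -/(lab x) -/(lab y) !thlab // /S !thlab //.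
    have := chiP kl; rewrite -prepr_partial // in kl; have := chiP kl.
    by rewrite pE // => <-; exact: addb_transpose.
  - by rewrite addbA addbb.
  - by rewrite addbC addbA addbb.
  - by rewrite (@ltC k l) ?neq_fst //; case: (lt k l); case: (S k l).
pose f (b : eppa_vertex) : eppa_vertex :=
  (th b.1, [ffun k => b.2 (invF thinj k) (+) F b.1 (invF thinj k)]).
have fE b k : (f b).2 (th k) = b.2 k (+) F b.1 k by rewrite ffunE invF_f.
exists f; split; first split.
- apply: injF_bij => b c fbc; have b1 : b.1 = c.1 by case: fbc => /thinj.
  case: b c b1 fbc => [k u] [l v] /= <- fbc; congr (_, _); apply/ffunP => l'.
  by move: (fE (k, u) l'); rewrite fbc fE => /addIb.
- move=> b c; rewrite /eppa_rel th1; have [//|bc] /= := eqVneq b.1.1 c.1.1.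
  by rewrite !fE addbACA FS // /S -!addbA addbb addbF.
- move=> x xD; rewrite /f /eppa_embed /= thlab //; congr (_, _).
  apply/ffunP => l.
  rewrite [LHS]ffunE -[in RHS](f_invF thinj l) /F /D2 /= xD eqxx.
  by rewrite [LHS]addbC -addbA addbb addbF.
Qed.

End Extend.
End Eppa.

(** * Homogeneity and universality *)

Lemma fraisse_restrict (C : finite_class) (V : countType) (E : rel V)
    (S : seq V) :
  fraisse_limit C E -> C (seq_sub S) (relpre val E).
Proof. by move=> [_ CE]; apply/CE; exists val; split=> //; exact: val_inj. Qed.

Lemma multipartite_of_parts (I T : Type) (e : rel T) :
  partite_tournament I e -> multipartite e.
Proof.
move=> [[irr asy] [A [cov _ adj nadj]]].
have part x : exists i, A i x.
  by have : [set: T] x by []; rewrite -cov => -[i _ Aix]; exists i.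
have adjE i j x y : A i x -> A j y -> nonadj e x y -> i = j.
  move=> Aix Ajy nxy; apply: contrapT => ij.
  by move: nxy; rewrite /nonadj (adj i j).
split=> [//|x y exy|y x z xy yz].
  apply/negP => eyx; have := asy x y; rewrite exy eyx => /(_ isT) xy.
  by rewrite xy irr in exy.
have [i Aix] := part x; have [j Ajy] := part y; have [k Akz] := part z.
have jk := adjE _ _ _ _ Ajy Akz yz; have ij := adjE _ _ _ _ Aix Ajy xy.
by rewrite /nonadj negb_or !(nadj i) //; rewrite ij jk.
Qed.

(** Numbering the parts by the ranks of their representatives leaves almost all indices to empty
    parts. *)
Lemma parts_of_multipartite (T : finType) (e : rel T) :
  multipartite e -> partite_tournament nat e.
Proof.
move=> eP; have [irr asy _] := eP; split.
  by split=> // x y /andP[/asy/negbTE->].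
exists (fun i => [set x | enum_rank (prepr e x) = i :> nat]); split.
- by rewrite -subTset => x _; exists (enum_rank (prepr e x)).
- by move=> i j ij; rewrite -subset0 => x [/= xi xj]; apply: ij; rewrite -xi.
- move=> i j x y ij /= xi yj; apply: contraT; rewrite -[~~ _]/(nonadj e x y).
  by rewrite -(preprP eP) => /eqP xy; case: ij; rewrite -xi -yj xy.
- move=> i x y /= <- /val_inj/enum_rank_inj/esym/eqP.
  by rewrite (preprP eP) /nonadj negb_or => /andP[].
Qed.

(** Homogeneity for two copies [a] and [b] of one finite configuration, which avoids writing down a
    partial map of [V]. *)
Lemma homogeneous_extend (V : countType) (E : rel V) (X : eqType) (S : seq X)
    (a b : X -> V) : homogeneous E ->
  {in S &, injective a} -> {in S &, injective b} ->
  {in S &, forall x y, E (b x) (b y) = E (a x) (a y)} ->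
  exists g : Aut E, {in S, forall x, g (a x) = b x}.
Proof.
move=> homE ainj binj abE.
have [->|[x0 _]] : S = [::] \/ exists x : X, True.
- by case: (S) => [|x0 S']; [left | right; exists x0].
- by exists (aut_one E).
pose p v := b (nth x0 S (index v (map a S))).
have pa : {in S, forall x, p (a x) = b x}.
  move=> x xS; rewrite /p; congr b; apply: ainj => //.
    by rewrite mem_nth // -(size_map a) index_mem map_f.
  rewrite -(nth_map x0 (a x0)) ?nth_index ?map_f //.
  by rewrite -(size_map a) index_mem map_f.
have [||||g gaut gp] := homE [set` map a S] [set` map b S] p.
- exact: finite_seq.
- exact: finite_seq.
- split=> [_ /= /mapP[x xS ->]|_ w /set_mem/mapP[x xS ->]|].
  + by rewrite pa // map_f.
  + by move=> /set_mem/mapP[y yS ->]; rewrite !pa // => /(binj _ _ xS yS)->.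
  + by move=> _ /= /mapP[x xS ->]; exists (a x); rewrite ?pa //= map_f.
- by move=> _ _ /mapP[x xS ->] /mapP[y yS ->]; rewrite !pa ?abE.
by exists (mkAut gaut) => x xS; rewrite -(pa x xS); apply: gp; rewrite /= map_f.
Qed.

(** Each axiom concerns at most three vertices, hence holds because it does in the finite
    substructures. *)
Lemma multipartite_limit (I : Type) (V : countType) (E : rel V) :
  fraisse_limit (finite_partite_tournament I) E -> multipartite E.
Proof.
move=> limE.
have sub x y z := multipartite_of_parts (fraisse_restrict [:: x; y; z] limE).
have mem (x y z : V) :
    [/\ x \in [:: x; y; z], y \in [:: x; y; z] & z \in [:: x; y; z]].
  by rewrite !inE !eqxx !orbT.
split=> [x|x y|y x z].
- have [irr _ _] := sub x x x; have [xS _ _] := mem x x x.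
  exact: irr (SeqSub xS).
- have [_ asy _] := sub x y y; have [xS yS _] := mem x y y.
  exact: asy (SeqSub xS) (SeqSub yS).
- have [_ _ tr] := sub x y z; have [xS yS zS] := mem x y z.
  exact: tr (SeqSub yS) (SeqSub xS) (SeqSub zS).
Qed.

Section OmegaLimit.
Variables (V : countType) (E : rel V).
Hypothesis limE : fraisse_limit (finite_partite_tournament nat) E.

Lemma embed_finite (X : choiceType) (d : rel X) (B : seq X) :
  multipartite d ->
  exists k : X -> V, {in B &, injective k} /\
    {in B &, forall x y, E (k x) (k y) = d x y}.
Proof.
move=> [irr asy tr]; have [_ univE] := limE.
have [v0 _] : exists v0 : V, True.
  have /univE[f _] : finite_partite_tournament nat (fun _ _ : unit => false).
    by apply: parts_of_multipartite; split.
  by exists (f tt).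
have /univE[f [finj fE]] :
    finite_partite_tournament nat (relpre val d : rel (seq_sub B)).
  apply: parts_of_multipartite; split=> [x|x y|y x z].
  - exact: irr.
  - exact: asy.
  - exact: tr.
exists (fun x => if insub x is Some s then f s else v0); split=> x y xB yB.
  by rewrite !insubT => /finj/(congr1 val).
by rewrite !insubT fE.
Qed.

(** Universality gives some copy of [B]; homogeneity then moves it so that it extends [b]. *)
Lemma embed_over (X : choiceType) (d : rel X) (B : seq X)
    (Y : eqType) (S : seq Y) (a : Y -> X) (b : Y -> V) :
  multipartite d -> {in S, forall y, a y \in B} ->
  {in S &, injective a} -> {in S &, injective b} ->
  {in S &, forall x y, E (b x) (b y) = d (a x) (a y)} ->
  exists k : X -> V, [/\ {in B &, injective k},
    {in B &, forall x y, E (k x) (k y) = d x y} &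
    {in S, forall y, k (a y) = b y}].
Proof.
move=> dP aB ainj binj abE; have [k [kinj kE]] := embed_finite B dP.
have [|||g gk] := @homogeneous_extend V E Y S (k \o a) b (proj1 limE) => //.
- by move=> x y xS yS /kinj/ainj; apply; rewrite ?aB.
- by move=> x y xS yS; rewrite abE //= kE ?aB.
exists (g \o k); split=> //.
- by move=> x y xB yB /aut_inj/kinj; apply.
- by move=> x y xB yB; rewrite /= aut_rel kE.
Qed.

Variable m : nat.
Implicit Types (h f : 'I_m -> Aut E) (S T W : seq V).

Definition stable h S := forall i x, x \in S -> h i x \in S.

Lemma stable_mem h S i x : stable h S -> (h i x \in S) = (x \in S).
Proof.
move=> hS; apply/idP/idP => [hxS|]; last exact: hS.
have sub : {subset map (h i) (undup S) <= undup S}.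
  by move=> _ /mapP[y yS ->]; rewrite mem_undup hS // -mem_undup.
have hU : uniq [seq h i y | y <- undup S].
  by rewrite map_inj_uniq ?undup_uniq //; exact: aut_inj.
have [|_ eqS] := uniq_min_size hU sub; first by rewrite size_map.
move: hxS; rewrite -mem_undup -eqS mem_map ?mem_undup //; exact: aut_inj.
Qed.

(** The EPPA witness of the finite substructure [A'] is realized in [V] over [A']. Each restriction
    of [h i] to [S] extends to an automorphism of the witness, and by homogeneity to [V]; the
    witness becomes the stable set [W]. *)
Lemma stable_dense h S : exists h' W,
  [/\ agree h S h', {subset S <= W} & stable h' W].
Proof.
pose A' := S ++ [seq h i x | i <- enum 'I_m, x <- S].
have SA : {subset S <= A'} by move=> x xS; rewrite mem_cat xS.
have hA i x : x \in S -> h i x \in A'.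
  move=> xS; rewrite mem_cat; apply/orP; right; apply/allpairsP.
  by exists (i, x); rewrite mem_enum.
pose A : finType := seq_sub A'; pose B := eppa_vertex A.
pose e : rel A := relpre val E.
have eP : multipartite e := multipartite_of_parts (fraisse_restrict A' limE).
have [jinj jE] := eppa_embedding eP.
have [|||||k [kinj kE kj]] := @embed_over B (@eppa_rel A) (enum B) A
  (enum A) (eppa_embed e) val.
- exact: multipartite_eppa.
- by move=> x _; rewrite mem_enum.
- by move=> x y _ _ /jinj.
- by move=> x y _ _ /val_inj.
- by move=> x y _ _; rewrite jE.
have kI : injective k by move=> x y; apply: kinj; rewrite mem_enum.
pose D : {pred A} := [pred a | val a \in S].
(* [A'] contains the images of [S], so the default of [insubd] is not taken on [D]. *)
pose p i (a : A) := insubd a (h i (val a)).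
have pV i : {in D, forall a, val (p i a) = h i (val a)}.
  by move=> a aD; rewrite val_insubd hA.
have ext i : exists h' : Aut E, (forall b, exists c, h' (k b) = k c) /\
    {in S, h' =1 h i}.
  have [||F [[/bij_inj Finj FE] Fp]] := @eppa_extend _ _ eP D (p i).
  - by move=> x y xD yD /(congr1 val); rewrite !pV // => /aut_inj/val_inj.
  - by move=> x y xD yD; rewrite /e /= !pV // aut_rel.
  have [|||h' h'k] :=
    @homogeneous_extend V E _ (enum B) k (k \o F) (proj1 limE) => //.
  - by move=> x y _ _ /kI/Finj.
  - by move=> x y _ _; rewrite /= !kE ?mem_enum // FE.
  exists h'; split=> [b|x xS]; first by exists (F b); rewrite h'k ?mem_enum.
  pose a : A := SeqSub (SA x xS).
  have := h'k (eppa_embed e a); rewrite mem_enum => /(_ isT).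
  by rewrite /= Fp // !kj ?mem_enum // pV.
have [h' h'P] := choice ext.
exists h', (map k (enum B)); split.
- by move=> i x xS; have [_ ->] := h'P i.
- move=> x xS; apply/mapP; exists (eppa_embed e (SeqSub (SA x xS))).
    by rewrite mem_enum.
  by rewrite kj ?mem_enum.
- move=> i _ /mapP[b _ ->]; have [/(_ b)[c ->] _] := h'P i.
  by rewrite map_f ?mem_enum.
Qed.

End OmegaLimit.

(** * Genericity with infinitely many parts *)

Lemma nonadj_aut (V : countType) (E : rel V) (g : Aut E) x y :
  nonadj E (g x) (g y) = nonadj E x y.
Proof. by rewrite /nonadj !aut_rel. Qed.

(** * Amalgamation of two copies over a finite set *)

Section Amalgam.
Variables (V : countType) (E : rel V) (S : seq V).
Hypothesis EP : multipartite E.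

(* x in the first copy of V and y in the second have to share a part. *)
Definition linked x y := has (fun s => nonadj E x s && nonadj E s y) S.

(** No quotient is taken: the shared points are the [inl s] with [s] in [S], and the [inr s] stay as
    spare vertices. Every other [inl x] points to all [inr y] outside its part. *)
Definition amalgam_rel : rel (V + V) := fun a b =>
  match a, b with
  | inl x, inl y | inr x, inr y => E x y
  | inl x, inr y => if x \in S then E x y else ~~ linked x y
  | inr y, inl x => if x \in S then E y x else false
  end.

Lemma linked_base x y : x \in S -> linked x y = nonadj E x y.
Proof.
move=> xS; apply/hasP/idP => [[s _ /andP[xs sy]]|xy].
  exact: (nonadj_trans EP xs sy).
by exists x; rewrite ?xy ?(nonadjxx EP).
Qed.

Lemma nonadj_amalgam a b : nonadj amalgam_rel a b =
  match a, b with
  | inl x, inl y | inr x, inr y => nonadj E x y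
  | inl x, inr y | inr y, inl x => linked x y
  end.
Proof.
case: a b => [x|x] [y|y] //=; rewrite /nonadj /=; case: ifP => [xS|_] //.
- by rewrite linked_base.
- by rewrite orbF negbK.
- by rewrite linked_base // nonadjC.
- by rewrite /= negbK.
Qed.

Lemma multipartite_amalgam : multipartite amalgam_rel.
Proof.
have [irr asy _] := EP; split.
- by move=> [x|x]; exact: irr.
- move=> [x|x] [y|y] /=; try exact: asy; case: ifP => // _; exact: asy.
- have trE := nonadj_trans EP.
  have lt x y z : nonadj E x y -> linked y z -> linked x z.
    move=> xy /hasP[s sS /andP[ys sz]]; apply/hasP; exists s => //.
    by rewrite sz (trE _ _ _ xy ys).
  have rt x y z : linked x y -> nonadj E y z -> linked x z.
    move=> /hasP[s sS /andP[xs sy]] yz; apply/hasP; exists s => //.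
    by rewrite xs (trE _ _ _ sy yz).
  have lrl x y z : linked x y -> linked z y -> nonadj E x z.
    move=> /hasP[s _ /andP[xs sy]] /hasP[t _ /andP[zt ty]].
    rewrite nonadjC in ty; rewrite nonadjC in zt.
    exact: trE (trE _ _ _ xs sy) (trE _ _ _ ty zt).
  have rlr x y z : linked y x -> linked y z -> nonadj E x z.
    move=> /hasP[s _ /andP[ys sx]] /hasP[t _ /andP[yt tz]].
    rewrite nonadjC in sx; rewrite nonadjC in ys.
    exact: trE (trE _ _ _ sx ys) (trE _ _ _ yt tz).
  move=> [y|y] [x|x] [z|z]; rewrite !nonadj_amalgam.
  + exact: trE.
  + exact: lt.
  + by rewrite (nonadjC _ y) => yx zy; exact: lt zy yx.
  + exact: rlr.
  + exact: lrl.
  + exact: rt.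
  + by rewrite nonadjC => yx zy; exact: rt zy yx.
  + exact: trE.
Qed.

Section Amalgamate.
Variables (h f : Aut E).
Hypotheses (hS : forall x, (h x \in S) = (x \in S)).
Hypothesis (fh : {in S, f =1 h}).

Definition amalgam_aut (a : V + V) : V + V :=
  match a with inl x => inl (h x) | inr y => inr (f y) end.

Lemma amalgam_aut_inj : injective amalgam_aut.
Proof. by move=> [x|x] [y|y] //= [/aut_inj->]. Qed.

(** New edges all have the same direction, and [linked] is invariant because [h] permutes [S] and
    [f] agrees with it there. *)
Lemma amalgam_aut_rel a b :
  amalgam_rel (amalgam_aut a) (amalgam_aut b) = amalgam_rel a b.
Proof.
have lhf x y : linked (h x) (f y) = linked x y.
  apply/hasP/hasP => [[s sS]|[s sS]].
    rewrite -(aut_invK h s) in sS *; rewrite hS in sS.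
    rewrite nonadj_aut -(fh sS) nonadj_aut => xsy.
    by exists (aut_inv h s).
  by move=> xsy; exists (h s); rewrite ?hS // nonadj_aut -(fh sS) nonadj_aut.
case: a b => [x|x] [y|y] /=; rewrite ?aut_rel ?hS ?lhf //; case: ifP => // xS.
  by rewrite -(fh xS) aut_rel.
by rewrite -(fh xS) aut_rel.
Qed.

End Amalgamate.

Definition amalgam_inr x : V + V := if x \in S then inl x else inr x.

Lemma amalgam_inr_inj : injective amalgam_inr.
Proof. by rewrite /amalgam_inr => x y; do 2!case: ifP => _ //; case. Qed.

Lemma amalgam_inr_rel x y : amalgam_rel (amalgam_inr x) (amalgam_inr y) = E x y.
Proof.
by rewrite /amalgam_inr; case: ifP => xS; case: ifP => yS //=; rewrite ?xS ?yS.
Qed.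

End Amalgam.

Section Generic.
Variables (V : countType) (E : rel V).
Hypothesis limE : fraisse_limit (finite_partite_tournament nat) E.
Let EP := multipartite_limit limE.

(** The amalgam of [W] and [T] is realized in [V] with [W] in place. Homogeneity turns the joint
    action on it into [h'], and the passage from [T] to its new copy into [k]. *)
Lemma amalgamate m (h f : 'I_m -> Aut E) (S T W : seq V) :
  {subset S <= T} -> {subset S <= W} -> stable h S -> stable h W ->
  stable f T -> (forall i, {in S, f i =1 h i}) ->
  exists (h' : 'I_m -> Aut E) (k : Aut E), [/\ agree h W h',
    {in S, forall x, k x = x} &
    forall i, {in T, forall x, k (f i x) = h' i (k x)}].
Proof.
move=> ST SW hS hW fT fh.
pose B := map inl W ++ map inr T : seq (V + V)%type.
have inlB w : w \in W -> inl w \in B by move=> wW; rewrite mem_cat map_f.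
have inrB t : t \in T -> inr t \in B by move=> tT; rewrite mem_cat map_f ?orbT.
have ioB t : t \in T -> amalgam_inr S t \in B.
  rewrite /amalgam_inr => tT.
  by case: ifP => [/SW|_]; [exact: inlB | exact: inrB].
have hSE i x : (h i x \in S) = (x \in S) := stable_mem i x hS.
have [|||||k0 [k0inj k0E k0W]] :=
  @embed_over _ _ limE (V + V)%type (amalgam_rel E S) B V W inl id.
- exact: multipartite_amalgam.
- exact: inlB.
- by move=> x y _ _ [].
- by [].
- by [].
have FB i : {in B, forall b, amalgam_aut (h i) (f i) b \in B}.
  move=> b; rewrite mem_cat => /orP[] /mapP[x xW ->] /=.
    by apply: inlB; exact: hW.
  by apply: inrB; exact: fT.
have ext i : exists g : Aut E,
    {in B, forall b, g (k0 b) = k0 (amalgam_aut (h i) (f i) b)}.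
  apply: (homogeneous_extend (proj1 limE) k0inj) => b c bB cB.
    by move=> /k0inj/amalgam_aut_inj; apply; exact: FB.
  by rewrite !k0E ?FB // amalgam_aut_rel.
have [h' h'P] := choice ext.
have [|||k kP] :=
  @homogeneous_extend V E V T id (k0 \o amalgam_inr S) (proj1 limE).
- by [].
- by move=> x y xT yT /k0inj/amalgam_inr_inj; apply; exact: ioB.
- by move=> x y xT yT; rewrite /= k0E ?ioB // amalgam_inr_rel.
exists h', k; split.
- move=> i w wW; rewrite -{1}(k0W w wW) h'P ?inlB //=.
  by rewrite k0W //; exact: hW.
- by move=> x xS; rewrite kP ?ST //= /amalgam_inr xS k0W ?SW.
- move=> i x xT; rewrite !kP //=; last exact: fT.
  rewrite h'P ?ioB // /amalgam_inr.
  (* [x] and [f i x] must fall into the same branch of [amalgam_inr]. *)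
  have -> : (f i x \in S) = (x \in S).
    apply/idP/idP => [fxS|xS]; last by rewrite fh // hSE.
    rewrite -(aut_invK (h i) (f i x)) hSE in fxS.
    have := fh i _ fxS; rewrite aut_invK => /aut_inj fxx.
    by rewrite fxx in fxS.
  by case: ifP => //= xS; rewrite fh.
Qed.

Variable m : nat.
Implicit Types (h f : 'I_m -> Aut E) (S T W : seq V).

Definition locally_finite h := forall x, exists2 S, x \in S & stable h S.

(* By universality and homogeneity, a finite extension of S with automorphisms
   can be taken to be an f-stable set T in V, for f automorphisms of V. *)
Definition extensible h := forall S T f, {subset S <= T} -> stable h S ->
  stable f T -> (forall i, {in S, f i =1 h i}) ->
  exists k : Aut E, {in S, forall x, k x = x} /\
    forall i, {in T, forall x, k (f i x) = h i (k x)}.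

Definition generic h := locally_finite h /\ extensible h.

Lemma agree_stable h h' S : agree h S h' -> stable h' S <-> stable h S.
Proof. by move=> hh'; split=> hS i x xS; have := hS i x xS; rewrite hh'. Qed.

Lemma agree_sub h h' S T : {subset S <= T} -> agree h T h' -> agree h S h'.
Proof. by move=> ST hh' i x /ST; apply: hh'. Qed.

Lemma agree_trans h h' h'' S : agree h S h' -> agree h' S h'' -> agree h S h''.
Proof. by move=> hh' h'h'' i x xS; rewrite h'h'' // hh'. Qed.

Lemma comeagre_generic : comeagre (generic : set {ptws 'I_m -> Aut E}).
Proof.
(* Extensions must be indexed by a countable type, so f is coded by its values
   on T, on which alone the second condition depends. *)
pose C : countType := (V + seq V * seq V * {ffun 'I_m -> seq V})%type.
pose bad (c : C) : set {ptws 'I_m -> Aut E} := match c with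
  | inl x => [set h | ~ exists2 S, x \in S & stable h S]
  | inr (S0, T0, c0) => [set h | exists f, [/\ (forall i, map (f i) T0 = c0 i),
      {subset S0 <= T0}, stable h S0 & stable f T0] /\
      [/\ (forall i, {in S0, f i =1 h i}) & ~ exists k : Aut E,
      {in S0, forall x, k x = x} /\
      forall i, {in T0, forall x, k (f i x) = h i (k x)}]]
  end.
apply: (@meagre_countable _ _ _ C bad); last first.
  move=> h; apply: contra_notP => nbad; split.
    by move=> x; apply: contrapT => nx; apply: nbad; exists (inl x).
  move=> S T f ST hS fT fh; apply: contrapT => nk; apply: nbad.
  exists (inr (S, T, [ffun i => map (f i) T])) => //.
  by exists f; split; split=> // i; rewrite ffunE.
move=> [x|[[S T] c]]; apply/nowhere_denseP => u R.
  have [h [W [uh RW hW]]] := stable_dense limE u (x :: R).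
  exists h, W => g gh; split.
    apply: agree_sub (agree_trans uh (agree_sub RW gh)) => y yR.
    by rewrite inE yR orbT.
  by case; exists W; [exact/RW/mem_head | exact/(agree_stable gh)].
have [h [W [uh RW hW]]] := stable_dense limE u (R ++ S).
have RRS : {subset R <= R ++ S} by move=> x xR; rewrite mem_cat xR.
have SRS : {subset S <= R ++ S} by move=> x xS; rewrite mem_cat xS orbT.
(* If the code [c] is met by some extension of [h] on [S], it is amalgamated with [W]; fixing the
   tuple also on [map k T] makes [k] work for every nearby tuple. *)
have [[f [[fc ST hS fT] fh]]|nf] := pselect (exists f, [/\
    (forall i, map (f i) T = c i), {subset S <= T}, stable h S & stable f T] /\
    forall i, {in S, f i =1 h i}).
  have SW : {subset S <= W} by move=> x /SRS/RW.
  have [h' [k [hh' kS kT]]] := amalgamate ST SW hS hW fT fh.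
  exists h', (W ++ map k T) => g gh'; split.
    apply: agree_sub RRS (agree_trans uh (agree_trans (agree_sub RW hh') _)).
    by apply: agree_sub gh' => x /RW xW; rewrite mem_cat xW.
  move=> [f' [[f'c _ _ _] [_]]]; apply; exists k; split=> // i x xT.
  have ff' : map (f' i) T = map (f i) T by rewrite f'c fc.
  rewrite (iffRL (eq_in_map _ _ _) ff' x xT) kT //.
  by rewrite gh' // mem_cat map_f ?orbT.
(* Otherwise no nearby tuple has an extension with this code, since compatibility depends only on
   the values on [S]. *)
exists h, (R ++ S) => g gh; split.
  exact: agree_sub RRS (agree_trans uh gh).
have ghS := agree_sub SRS gh.
move=> [f [[fc ST gS fT] [fg _]]]; apply: nf; exists f; split; first split=> //.
  exact/(agree_stable ghS).
by move=> i x xS; rewrite fg // ghS.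
Qed.

(** A finite partial conjugation, stored as a full automorphism of which only the restriction to
    [p.1] counts. *)
Definition partial_conj h h' (p : seq V * Aut E) :=
  stable h p.1 /\ forall i, {in p.1, forall x, p.2 (h i x) = h' i (p.2 x)}.

Lemma stable_cat h S T : stable h S -> stable h T -> stable h (S ++ T).
Proof.
move=> hS hT i x; rewrite !mem_cat => /orP[xS|xT]; first by rewrite hS.
by rewrite hT ?orbT.
Qed.

(** Transporting [h] by [q] makes the image of [T] an extension of the [h']-stable image of [S];
    extensibility of [h'] realizes it by some [k], and [q] is replaced by [k] after [q]. *)
Lemma conj_forth h h' p x : locally_finite h -> extensible h' ->
  partial_conj h h' p -> exists2 p', partial_conj h h' p' &
  [/\ {subset p.1 <= p'.1}, x \in p'.1 & {in p.1, p'.2 =1 p.2}].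
Proof.
case: p => S q hfin h'ext [/= hS qS]; have [T0 xT0 hT0] := hfin x.
pose T := S ++ T0; have hT : stable h T by exact: stable_cat.
have ST : {subset S <= T} by move=> y yS; rewrite mem_cat yS.
pose f i := aut_mul (aut_mul q (h i)) (aut_inv q).
have fE i y : f i (q y) = q (h i y).
  by rewrite -[f i (q y)]/(q (h i (aut_inv q (q y)))) aut_funK.
have [|i _ /mapP[y yS ->]|i _ /mapP[y yT ->]|i _ /mapP[y yS ->]|k [kS kT]] :=
    h'ext (map q S) (map q T) f.
- by move=> _ /mapP[y /ST yT ->]; rewrite map_f.
- by rewrite -qS // map_f // hS.
- by rewrite fE map_f // hT.
- by rewrite fE qS.
exists (T, aut_mul k q); split=> //=.
- move=> i y yT.
  by rewrite -[RHS]/(h' i (k (q y))) -kT ?map_f // fE.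
- by rewrite mem_cat xT0 orbT.
- by move=> y yS; rewrite -[LHS]/(k (q y)) kS // map_f.
Qed.

(** The forth step for the inverse partial conjugation, inverted again. *)
Lemma conj_back h h' p y : locally_finite h' -> extensible h ->
  partial_conj h h' p -> exists2 p', partial_conj h h' p' &
  [/\ {subset p.1 <= p'.1}, exists2 x, x \in p'.1 & p'.2 x = y &
      {in p.1, p'.2 =1 p.2}].
Proof.
case: p => S q h'fin hext [/= hS qS].
have [|[T r] [/= h'T rT] [/= ST yT rq]] :=
    @conj_forth h' h (map q S, aut_inv q) y h'fin hext.
  split=> /= [i _ /mapP[x xS ->]|i _ /mapP[x xS ->]].
    by rewrite -qS // map_f // hS.
  by rewrite -qS // !aut_funK.
have rqx x : x \in S -> r (q x) = x by move=> xS; rewrite rq ?map_f // aut_funK.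
exists (map r T, aut_inv r); split=> /=.
- by move=> i _ /mapP[t tT ->]; rewrite -rT // map_f // h'T.
- by move=> i _ /mapP[t tT ->]; rewrite -rT // !aut_funK.
- by move=> x xS; rewrite -(rqx x xS) map_f // ST // map_f.
- by exists (r y); rewrite ?map_f // aut_funK.
- by move=> x xS; rewrite -{1}(rqx x xS) aut_funK.
Qed.

Lemma generic_conj h h' : generic h -> generic h' ->
  exists g : Aut E, forall i x, g (h i x) = h' i (g x).
Proof.
move=> [hfin hext] [h'fin h'ext].
pose R n (p p' : seq V * Aut E) := [/\ {subset p.1 <= p'.1},
  {in p.1, p'.2 =1 p.2} & forall x, unpickle n = Some x ->
    x \in p'.1 /\ exists2 z, z \in p'.1 & p'.2 z = x].
have [||w _ wR] := @choice_seq _ (partial_conj h h') R ([::], aut_one E).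
- by split.
- move=> n p pP.
  (* Numbers that code no vertex give an idle step. *)
  have [[x nx]|nx] := pselect (exists x : V, unpickle n = Some x); last first.
    by exists p => //; split=> // x nxx; case: nx; exists x.
  have [p1 p1P [pp1 xp1 p1q]] := conj_forth x hfin h'ext pP.
  have [p2 p2P [p12 [z zp2 p2z] p2q]] := conj_back x h'fin hext p1P.
  exists p2 => //; split=> [y yp|y yp|y].
  + exact/p12/pp1.
  + by rewrite p2q ?p1q // pp1.
  + rewrite nx => -[<-]; split; first exact: p12.
    by exists z.
have wP n := proj1 (wR n); have Rw n := proj2 (wR n).
have [n|n x xw|x|x|g gw] :=
  @aut_limit V E (fun n => (w n).2) (fun n => (w n).1).
- by have [] := Rw n.
- by have [_ -> ] := Rw n.
- have [_ _ /(_ x)] := Rw (pickle x); rewrite pickleK => /(_ erefl)[xw _].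
  by exists (pickle x).+1.
- have [_ _ /(_ x)] := Rw (pickle x); rewrite pickleK => /(_ erefl)[_].
  by exists (pickle x).+1.
exists g => i x.
have [_ _ /(_ x)] := Rw (pickle x); rewrite pickleK => /(_ erefl)[xw _].
have [hw qw] := wP (pickle x).+1.
by rewrite (gw _ _ xw) -qw // (gw _ _ (hw i x xw)).
Qed.

Lemma generic_automorphisms : has_generic_automorphisms m E.
Proof.
have [h hG] := comeagre_nonempty comeagre_generic.
exists h; have [F F0 FG] := comeagre_generic; exists F => // h' nh'.
apply: FG => h'G; apply: nh'; have [g gP] := generic_conj hG h'G.
exists g; apply/funext => i; apply: aut_ext => x.
by rewrite -[RHS]/(g (h i (aut_inv g x))) gP aut_invK.
Qed.

End Generic.

(** * Finitely many parts *)

Section FiniteLimit.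
Variables (n : nat) (V : countType) (E : rel V).
Hypothesis n2 : 2 <= n.
Hypothesis limE : fraisse_limit (finite_partite_tournament 'I_n) E.
Let EP := multipartite_limit limE.

(** The order of ['I_n] is an [n]-partite tournament with singleton parts, so it embeds and gives
    [n] pairwise adjacent vertices. They occupy all [n] parts of any finite substructure containing
    them, so a further vertex [x] shares a part with one of them. *)
Lemma parts_transversal : exists f : 'I_n -> V,
  (forall i j, nonadj E (f i) (f j) -> i = j) /\
  forall x, exists i, nonadj E x (f i).
Proof.
have [f [finj fE]] : exists f : 'I_n -> V,
    embedding (fun i j : 'I_n => i < j) E f.
  have [_ univE] := limE; apply/univE; split.
    split=> [i|i j /andP[ij ji]]; first exact: ltnn.
    by have := ltn_trans ij ji; rewrite ltnn.
  exists (fun i => [set i]); split.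
  - by rewrite -subTset => i _; exists i.
  - by move=> i j ij; rewrite -subset0 => k [/= -> /ij].
  - by move=> i j _ _ ij -> ->; rewrite -neq_ltn; apply/eqP => /val_inj.
  - by move=> i _ _ -> ->; rewrite ltnn.
have fadj i j : nonadj E (f i) (f j) -> i = j.
  by rewrite /nonadj !fE -neq_ltn negbK => /eqP/val_inj.
exists f; split=> // x; pose S := x :: [seq f i | i <- enum 'I_n].
have fS i : f i \in S by rewrite inE map_f ?orbT // mem_enum.
have xS : x \in S by exact: mem_head.
have [_ [A [cov _ _ nadj]]] := fraisse_restrict S limE.
have part (s : seq_sub S) : exists i, A i s.
  by have : [set: seq_sub S] s by []; rewrite -cov => -[i _ Ais]; exists i.
have [c cP] := choice (fun i => part (SeqSub (fS i))).
have cinj : injective c.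
  move=> i j cij; apply: fadj; rewrite /nonadj negb_or.
  have cPj := cP j; rewrite -cij in cPj.
  by rewrite (nadj _ _ _ (cP i) cPj) (nadj _ _ _ cPj (cP i)).
have [k Akx] := part (SeqSub xS); exists (invF cinj k).
have := cP (invF cinj k); rewrite f_invF => Akf.
by rewrite /nonadj negb_or (nadj _ _ _ Akx Akf) (nadj _ _ _ Akf Akx).
Qed.

(** Let [N] be the normal subgroup fixing every part. Conjugates of an [h] in [N] cannot move [f i0]
    to [f i1], which lies in another part. If [h] is outside [N], no conjugate fixes all [f i], as
    that would fix every part. Both conditions define nonempty open sets, the first one containing
    [q]. *)
Lemma conj_class_dichotomy : exists (f : 'I_n -> V) (x y : V) (q : Aut E),
  q x = y /\ forall h : Aut E,
    (forall k : Aut E, aut_fun (k * h * k^-1)%g x <> y) \/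
    (forall k : Aut E, ~ forall i, aut_fun (k * h * k^-1)%g (f i) = f i).
Proof.
have [f [fadj fcov]] := parts_transversal; have trE := nonadj_trans EP.
pose i0 := Ordinal (ltnW n2); pose i1 := Ordinal n2.
have [||||q qP] :=
  @homogeneous_extend V E unit [:: tt] (fun=> f i0) (fun=> f i1).
- exact: (proj1 limE).
- by move=> [] [].
- by move=> [] [].
- by move=> [] [] _ _; rewrite !(multipartite_irr EP).
exists f, (f i0), (f i1), q; split; first by apply: (qP tt); rewrite inE.
move=> h; pose N (g : Aut E) := forall x, nonadj E (g x) x.
have Nconj (g k : Aut E) : N g -> N (k * g * k^-1)%g.
  move=> Ng x; rewrite -{2}(aut_invK k x).
  by rewrite -[aut_fun (_ * _)%g x]/(k (g (aut_inv k x))) nonadj_aut.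
have [Nh|nNh] := pselect (N h); [left=> k hk|right=> k hk].
  have := Nconj h k Nh (f i0); rewrite hk nonadjC => /fadj/(congr1 val).
  by [].
apply: nNh; have : N (k * h * k^-1)%g.
  move=> x; have [i xi] := fcov x.
  have gxi : nonadj E (aut_fun (k * h * k^-1)%g x) (f i).
    by rewrite -(hk i) nonadj_aut.
  by apply: trE gxi _; rewrite nonadjC.
move=> /(Nconj _ (k^-1)%g); rewrite invgK !mulgA mulVg mul1g -mulgA mulVg mulg1.
by [].
Qed.

Lemma no_dense_conj_class : ~ has_dense_conj_class E.
Proof.
have [f [x [y [q [qx dich]]]]] := conj_class_dichotomy; move=> [h hd].
have [nx|nf] := dich h.
  have [||g [gx [k gk]]] := hd [set g | aut_fun g x = y].
  - by exists q.
  - exact: open_aut_eval.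
  - by apply: (nx k); rewrite -gk.
have [||g [gf [k gk]]] := hd [set g | forall i, aut_fun g (f i) = f i].
- by exists (aut_one E).
- rewrite openE => g gf; apply: (@filter_forall _ _ _ _ (nbhs_filter g)) => i.
  by apply: open_nbhs_nbhs; split; [exact: open_aut_eval | exact: gf].
- by apply: (nf k); rewrite -gk.
Qed.

(** The orbit misses a nonempty basic open set, which would then be meagre. *)
Lemma no_generic_automorphism : ~ has_generic_automorphisms 1 E.
Proof.
have [f [x [y [q [qx dich]]]]] := conj_class_dichotomy; move=> [h [F F0 hF]].
have [nx|nf] := dich (h ord0).
  apply: (@agree_not_meagre _ _ 1 (fun=> q) [:: x]); exists F => // u uq.
  apply: hF => -[k uk]; apply: (nx k).
  by have := uq ord0 x (mem_head _ _); rewrite uk qx.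
apply: (@agree_not_meagre _ _ 1 (fun=> aut_one E) (map f (enum 'I_n))).
exists F => // u uf; apply: hF => -[k uk]; apply: (nf k) => i.
by have := uf ord0 (f i); rewrite uk; apply; rewrite map_f ?mem_enum.
Qed.

End FiniteLimit.

Theorem theorem1p5 :
  (forall (V : countType) (E : rel V),
     fraisse_limit (finite_partite_tournament nat) E -> ample_generics E) /\
  (forall n : nat, (2 <= n)%N ->
   forall (V : countType) (E : rel V),
     fraisse_limit (finite_partite_tournament 'I_n) E ->
     ~ has_generic_automorphisms 1 E /\ ~ has_dense_conj_class E).
Proof.
split=> [V E limE m _|n n2 V E limE]; first exact: generic_automorphisms.
split; first exact: no_generic_automorphism n2 limE.
exact: no_dense_conj_class n2 limE.
Qed.
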